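(* Let $G$ be the non-abelian group of order $27$ and exponent $3$. Every sequence of length $33$ over $G$ contains a product-one subsequence of length $27$. Consequently $\mathsf{E}(G)=33$, and in particular $\mathsf{E}(G)=\mathsf{d}(G)+|G|$.
   Context: A sequence over $G$ is a finite unordered list (multiset) of elements of $G$; a subsequence is a sub-multiset; a non-empty sequence is product-one if some ordering of its terms has product $1$. The Gao constant $\mathsf{E}(G)$ is the least integer $N$ such that every sequence over $G$ of length at least $N$ has a product-one subsequence of length $|G|$. The small Davenport constant $\mathsf{d}(G)$ is the maximal length of a sequence over $G$ with no non-empty product-one subsequence. *)

(* Defs.v *)
From mathcomp Require Import all_boot all_fingroup all_solvable.
Set Implicit Arguments. Unset Strict Implicit. Unset Printing Implicit Defensive.

Section ZeroSum.
Variable gT : finGroupType.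
Local Open Scope group_scope.

(* A sequence over G: a finite list whose terms all lie in G (order is
   irrelevant in all notions below). *)
Definition seq_over (G : {set gT}) (s : seq gT) : bool := all (mem G) s.

Definition product_one (s : seq gT) : Prop :=
  s != [::] /\ exists2 t : seq gT, perm_eq t s & \prod_(x <- t) x = 1.

(* Subsequences (sub-multisets) are represented as masks of s. *)
Definition has_p1_subseq_of_length (s : seq gT) (k : nat) : Prop :=
  exists m : bitseq, size (mask m s) = k /\ product_one (mask m s).

Definition has_nonempty_p1_subseq (s : seq gT) : Prop :=
  exists m : bitseq, product_one (mask m s).

Definition gao_property (G : {set gT}) (N : nat) : Prop :=
  forall s, seq_over G s -> N <= size s -> has_p1_subseq_of_length s #|G|.

Definition is_gao_constant (G : {set gT}) (N : nat) : Prop :=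
  gao_property G N /\ forall N', gao_property G N' -> N <= N'.

Definition is_small_davenport (G : {set gT}) (d : nat) : Prop :=
  (exists s, [/\ seq_over G s, size s = d & ~ has_nonempty_p1_subseq s]) /\
  (forall s, seq_over G s -> ~ has_nonempty_p1_subseq s -> size s <= d).

End ZeroSum.

(* Main.v *)
Require Import Defs.
From mathcomp Require Import all_boot all_fingroup all_solvable.
From mathcomp Require Import zify.

(** Choose noncommuting [x], [y] and let [z = [y, x]], which is central. Every
    element is [x^a y^b z^(c + 2ab)] with unique residues [a, b, c] modulo 3, and
    a word multiplies to the sum of its coordinates plus, in the last one, the
    alternating form [ab' - a'b] summed over its ordered pairs of letters. Call
    [(a, b)] the class of a letter. A word of class sum zero that contains two
    disjoint noncommuting pairs attains every central value under reordering.

    Among 33 classes, an exhaustive search finds a zero-sum 6-subsequence with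
    two such pairs, or 31 letters on one line of the plane (an abelian subgroup
    of order 9), or 29 letters of one class, or 27 letters of one class and a
    zero-sum 6-subsequence with one noncommuting pair. In the first case zero-sum
    triples of classes, which exist among any 9, complete the word to length 27;
    in the abelian cases zero-sum triples do nearly everything; in the last case
    either the 27 letters are equal, or exchanging two different ones supplies
    the freedom of a second noncommuting pair. A similar search over 7 classes
    gives [d(G) <= 6]. The sequence [x, x, y, y, z, z], extended by 26 copies of
    the identity, shows that both bounds are sharp. *)

Set Implicit Arguments.
Unset Strict Implicit.
Unset Printing Implicit Defensive.

(** * Exhaustive search over multiplicity vectors *)

(* Branches over the multiplicities of the remaining [w] classes, where [K] stands
   for "at least [K]"; [pats] holds the unread parts of the patterns that fit so
   far. The first branch is an [if] because [vm_compute] evaluates both arguments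
   of [||]. *)
Fixpoint search (K : nat) (leaf : pred (seq nat)) (pats : seq (seq nat))
    (w : nat) (pre : seq nat) : bool :=
  if has (all (pred1 0)) pats then true else
  if w is w'.+1 then
    all (fun c => search K leaf [seq behead p | p <- pats & head 0 p <= c] w'
                        (c :: pre))
        (iota 0 K.+1)
  else leaf (rev pre).

(** Follow the branch that reads [minn K] of each entry of [n]: a pattern that fits the capped
    entries also fits the true ones. *)
Lemma search_sound K leaf w pats pre n :
  search K leaf pats w pre -> size n = w ->
  (exists2 p, p \in pats & forall i, nth 0 p i <= nth 0 n i) \/
  leaf (rev pre ++ map (minn K) n).
Proof.
have null p i : all (pred1 0) p -> nth 0 p i = 0.
  move/(all_nthP 0)/(_ i); case: ltnP => [_ /(_ isT)/eqP //|le_i _].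
  exact: nth_default.
elim: w pats pre n => [|w IHw] pats pre n /=; case: hasP => [[p pin p0] _ _|_].
- by left; exists p => // i; rewrite null.
- by move=> lf /size0nil->; rewrite cats0; right.
- by left; exists p => // i; rewrite null.
case: n => // c0 n cov [szn].
have cin : minn K c0 \in iota 0 K.+1 by rewrite mem_iota ltnS geq_minl.
pose sub c := search K leaf [seq behead p | p <- pats & head 0 p <= c] w (c :: pre).
have := @allP _ sub (iota 0 K.+1) cov _ cin.
case/IHw/(_ szn) => [[q /mapP[p]]|].
  rewrite mem_filter => /andP[hp pin] -> le_n; left; exists p => // -[|i].
    by rewrite nth0 (leq_trans hp) // geq_minr.
  by have := le_n i; rewrite nth_behead.
by rewrite rev_cons cat_rcons; right.
Qed.

Definition mult (p : seq nat) : seq nat := [seq count_mem k p | k <- iota 0 9].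

Definition part (P : pred nat) (a : seq nat) : seq nat :=
  [seq nth 0 a i | i <- iota 0 9 & P i].

(** * Picking letters whose classes form a given pattern *)

Section Picking.
Variables (T : eqType) (cls : T -> nat).
Implicit Types s t r : seq T.

(** The letters of [t] come in the order of [p], so noncommuting pairs placed first in a pattern are
    the first letters of [t]. *)
Lemma pick_pattern s (p : seq nat) :
  (forall k, count_mem k p <= count_mem k (map cls s)) ->
  exists t r, perm_eq s (t ++ r) /\ map cls t = p.
Proof.
elim: p s => [|k p IHp] s le_ps; first by exists [::], s.
have /mapP[x xs kE] : k \in map cls s.
  by rewrite -has_pred1 has_count (leq_trans _ (le_ps k)) //= eqxx.
have sE := perm_to_rem xs.
have [|t [r [tr tp]]] := IHp (rem x s).
  move=> j; have := le_ps j; rewrite (seq.permP (perm_map cls sE)) /= -kE.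
  by rewrite leq_add2l.
exists (x :: t), r; split; last by rewrite /= tp -kE.
by apply: perm_trans sE _; rewrite /= perm_cons.
Qed.

(** The vector that reaches a leaf of the search: an entry below [K] is exact, an entry [K] may hide
    a larger count. *)
Definition capped K s := [seq minn K (count_mem k (map cls s)) | k <- iota 0 9].

Lemma part_capped K P s :
  part P (capped K s) =
  [seq minn K (count_mem k (map cls s)) | k <- iota 0 9 & P k].
Proof.
apply/eq_in_map => k; rewrite mem_filter mem_iota => /and3P[_ _ k9].
by rewrite (nth_map 0) ?size_iota // nth_iota.
Qed.

Lemma sum_counts P s : all (fun x => cls x < 9) s ->
  sumn [seq count_mem k (map cls s) | k <- iota 0 9 & P k] =
  count (fun x => P (cls x)) s.
Proof.
set l := filter P _.
have addE (F H : nat -> nat) u :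
    sumn [seq F k + H k | k <- u] = sumn (map F u) + sumn (map H u).
  by elim: u => //= k u ->; lia.
elim: s => [|x s IHs]; first by move=> _; elim: (l) => //= k u ->.
case/andP=> /= x9 /IHs IH; rewrite [RHS]/= -IH.
rewrite (addE (fun k => cls x == k) (fun k => count_mem k (map cls s))).
congr (_ + _); rewrite (sumn_count (fun k => cls x == k)).
rewrite (@eq_count _ _ (pred1 (cls x))) => [|k]; last exact: eq_sym.
by rewrite count_uniq_mem ?filter_uniq ?iota_uniq // mem_filter mem_iota x9 !andbT.
Qed.

Lemma part_le K P s : all (fun x => cls x < 9) s ->
  sumn (part P (capped K s)) <= count (fun x => P (cls x)) s.
Proof.
move=> s9; rewrite part_capped -sum_counts //.
by elim: (filter P _) => //= k l; have := geq_minr K (count_mem k (map cls s)); lia.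
Qed.

Lemma part_small K P s : all (fun x => cls x < 9) s ->
  all (fun c => c < K) (part P (capped K s)) ->
  count (fun x => P (cls x)) s = sumn (part P (capped K s)).
Proof.
move=> s9; rewrite part_capped -sum_counts //.
elim: (filter P _) => //= k l IHl /andP[lt_k /IHl ->].
by congr (_ + _); lia.
Qed.

Lemma search_pick K leaf pats s :
  all (all (fun k => k < 9)) pats ->
  search K leaf (undup (map mult pats)) 9 [::] ->
  (exists p, p \in pats /\
     exists t r, perm_eq s (t ++ r) /\ map cls t = p) \/
  leaf (capped K s).
Proof.
move=> pats9 /(@search_sound _ _ _ _ _ (mult (map cls s))).
rewrite size_map size_iota => /(_ erefl) [[q]|]; last first.
  by rewrite -map_comp; right.
rewrite mem_undup => /mapP[p pin ->] le_ps; left; exists p; split=> //.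
apply: pick_pattern => k; have [k9|k9] := ltnP k 9.
  by have := le_ps k; rewrite !(nth_map 0) ?size_iota // nth_iota.
rewrite (_ : count_mem k p = 0) //; apply/count_memPn/negP => kp.
by have := allP (allP pats9 _ pin) _ kp; rewrite ltnNge k9.
Qed.

(** Greedy extraction: the size hypothesis, written without subtraction, leaves [N] letters just
    before the last of the [m] triples. *)
Lemma pick_iter (D : pred T) (P : seq T -> Prop) N m s :
  P [::] -> (forall t u, P t -> P u -> P (t ++ u)) ->
  (forall u, all D u -> N <= size u ->
     exists t r, [/\ perm_eq u (t ++ r), size t = 3 & P t]) ->
  all D s -> N + 3 * m <= size s + 3 ->
  exists t r, [/\ perm_eq s (t ++ r), size t = 3 * m & P t].
Proof.
move=> P0 PD ex3; elim: m s => [|m IHm] s Ds le_s; first by exists [::], s.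
have [|t [r [st t3 Pt]]] := ex3 s Ds; first by lia.
have sz := perm_size st; rewrite size_cat in sz.
have [||u [v [ru um Pu]]] := IHm r.
- by move: Ds; rewrite (perm_all _ st) all_cat => /andP[].
- lia.
exists (t ++ u), v; split; last exact: PD.
  by rewrite (perm_trans st) // -catA perm_cat2l.
by rewrite size_cat t3 um; lia.
Qed.

End Picking.

(** * Zero-sum patterns in the plane over [F_3] *)

(* The class [(a, b)] is coded by the number [3 * a + b < 9]. *)
Definition form (a b a' b' : nat) : nat := (a * b' + 2 * b * a') %% 3.

Definition cform (p q : nat) : nat := form (p %/ 3) (p %% 3) (q %/ 3) (q %% 3).

Definition zero_sum (p : seq nat) : bool :=
  (3 %| sumn [seq k %/ 3 | k <- p]) && (3 %| sumn [seq k %% 3 | k <- p]).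

Fixpoint multisets (m : nat) : seq (seq nat) :=
  if m is m'.+1 then
    [seq k :: l | k <- iota 0 9, l <- [seq l <- multisets m' | all (leq k) l]]
  else [:: [::]].

Definition pairs : seq (seq nat) :=
  [seq p <- multisets 2 | cform (nth 0 p 0) (nth 0 p 1) != 0].

Definition starts_two_pairs (p : seq nat) : bool :=
  if p is [:: a, b, c, d & _] then (cform a b != 0) && (cform c d != 0)
  else false.

Definition starts_pair (p : seq nat) : bool :=
  if p is [:: a, b & _] then cform a b != 0 else false.

Definition zero_pats (ms : seq nat) : seq (seq nat) :=
  [seq p <- flatten [seq multisets m | m <- ms] | zero_sum p].

Definition two_pair_pats (m : nat) : seq (seq nat) :=
  [seq p <- [seq P ++ Q | P <- pairs,
                          Q <- [seq Q ++ l | Q <- pairs, l <- multisets m]]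
   | starts_two_pairs p && zero_sum p].

Definition one_pair_pats (m : nat) : seq (seq nat) :=
  [seq p <- [seq P ++ l | P <- pairs, l <- multisets m]
   | starts_pair p && zero_sum p].

(** The search does not fix the length of the word; this discards the vectors, free of truncated
    entries, of words that are too short. *)
Definition small (K N : nat) (a : seq nat) : bool :=
  all (fun c => c < K) (part predT a) && (sumn (part predT a) < N).

(** Directions (0,1), (1,0), (1,1), (1,2) of the four lines through the origin; class [k] lies on
    the line of [d] when [cform d k] is 0. *)
Definition lines : seq nat := [:: 1; 3; 4; 5].

(** At most 2, 4 or 6 letters outside a line or class leave 31, 29 or 27 of the 33 inside. Outside
    letters are counted because their entries are exact, while large entries are truncated. *)
Definition leaf33 (sp : seq (seq nat)) (a : seq nat) : bool :=
  if small 4 33 a then true else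
  if has (fun d => let o := part (fun k => cform d k != 0) a in
            all (fun c => c < 4) o && (sumn o <= 2)) lines then true else
  has (fun v => let o := part (predC1 v) a in
         if ~~ all (fun c => c < 4) o then false else
         if sumn o <= 4 then true else
         if 6 < sumn o then false else
         has (fun p => (count_mem v p <= 4) &&
                all (fun k => count_mem k p <= nth 0 a k) (iota 0 9)) sp)
      (iota 0 9).

Definition leaf7 (a : seq nat) : bool :=
  if small 5 7 a then true else
  has (fun d => 5 <= sumn (part (fun k => cform d k == 0) a)) lines.

Definition small_on (D : pred nat) (K N : nat) (a : seq nat) : bool :=
  small K N a || has (fun k => ~~ D k && (0 < nth 0 a k)) (iota 0 9).

Lemma mem_multisets m p :
  p \in multisets m -> size p = m /\ all (fun k => k < 9) p.
Proof.
elim: m p => [|m IHm] p; first by rewrite inE => /eqP->.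
case/allpairsPdep=> k [l [k9]]; rewrite mem_filter => /andP[_ /IHm[<- l9]] ->.
by rewrite /= l9 andbT; split=> //; move: k9; rewrite mem_iota.
Qed.

Lemma mem_pairs p : p \in pairs -> size p = 2 /\ all (fun k => k < 9) p.
Proof. by rewrite mem_filter => /andP[_ /mem_multisets]. Qed.

Lemma mem_zero_pats ms p : p \in zero_pats ms ->
  [/\ zero_sum p, size p \in ms & all (fun k => k < 9) p].
Proof.
by rewrite mem_filter => /andP[zp /flatten_mapP[m mms /mem_multisets[-> p9]]].
Qed.

Lemma mem_one_pair_pats m p : p \in one_pair_pats m ->
  [/\ starts_pair p, zero_sum p, size p = 2 + m & all (fun k => k < 9) p].
Proof.
rewrite mem_filter -andbA => /and3P[op zp].
case/allpairsPdep=> q [l [/mem_pairs[sq q9] /mem_multisets[sl l9] E]].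
by split; rewrite // E ?size_cat ?sq ?sl // all_cat q9.
Qed.

Lemma mem_two_pair_pats m p : p \in two_pair_pats m ->
  [/\ starts_two_pairs p, zero_sum p, size p = 4 + m & all (fun k => k < 9) p].
Proof.
rewrite mem_filter -andbA => /and3P[op zp].
case/allpairsPdep=> q [r [/mem_pairs[sq q9] /allpairsPdep[q' [l]]]].
case=> /mem_pairs[sq' q9'] /mem_multisets[sl l9] rE E.
by split; rewrite // E rE ?size_cat ?sq ?sq' ?sl // !all_cat q9 q9'.
Qed.

(** A triple uses a class at most three times, so the cap 3 loses no pattern. *)
Lemma search_triple :
  search 3 (small_on predT 3 9) (undup (map mult (zero_pats [:: 3]))) 9 [::].
Proof. by vm_compute. Qed.

Lemma search_six :
  search 6 (small_on predT 6 10) (undup (map mult (zero_pats [:: 6]))) 9 [::].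
Proof. by vm_compute. Qed.

(** The Erdos-Ginzburg-Ziv theorem for the group of order 3, placed on the axis [b = 0] of the
    plane. *)
Lemma search_triple_axis :
  search 3 (small_on (fun k => k %% 3 == 0) 3 5) (undup (map mult (zero_pats [:: 3])))
        9 [::].
Proof. by vm_compute. Qed.

(** The Davenport constant of the plane is at most 5. *)
Lemma search_davenport :
  search 3 (small_on predT 3 5)
    (undup (map mult (zero_pats (iota 1 5)))) 9 [::].
Proof. by vm_compute. Qed.

(** The two classes of a noncommuting pair differ, so a pattern uses a class at most once in each
    pair and twice more: the cap 4 loses none. *)
Lemma search_33 :
  search 4 (leaf33 (one_pair_pats 4)) (undup (map mult (two_pair_pats 2))) 9 [::].
Proof. by vm_compute. Qed.

(** The cap 5 lets [leaf7] see five letters of one class. The 0 put before the last patterns is a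
    central letter, whose use or omission replaces a second pair. *)
Lemma search_7 :
  search 5 leaf7
    (undup (map mult (flatten [seq two_pair_pats m | m <- iota 0 3] ++
                      map (cons 0) (one_pair_pats 1)))) 9 [::].
Proof. by vm_compute. Qed.

Lemma formE a b a' b' :
  form a b a' b' = form (a %% 3) (b %% 3) (a' %% 3) (b' %% 3).
Proof.
rewrite /form -[LHS]modnDm -[RHS]modnDm; congr ((_ + _) %% 3).
  by rewrite modnMm.
by rewrite -!mulnA -[LHS]modnMmr -[RHS]modnMmr modnMm.
Qed.

(** * Zero-sum subsequences of words with two coordinates modulo 3 *)

Section PlanePicking.
Variables (T : eqType) (f g : T -> nat).
Implicit Types s t : seq T.

Let in3 := fun x => (f x < 3) && (g x < 3).
Definition code x := 3 * f x + g x.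
(** Abstract [f] and [g] serve three times: for classes ([cA], [cB]), for an abelian subgroup of
    order 9 ([key d], [cC]), and inside one class ([cC], 0). *)
Definition sum0 s := (3 %| sumn (map f s)) && (3 %| sumn (map g s)).

Lemma code_div x : in3 x -> code x %/ 3 = f x.
Proof. by rewrite /in3 /code; lia. Qed.

Lemma code_mod x : in3 x -> code x %% 3 = g x.
Proof. by rewrite /in3 /code; lia. Qed.

Lemma code_lt9 s : all in3 s -> all (fun x => code x < 9) s.
Proof. by apply: sub_all => x; rewrite /in3 /code; lia. Qed.

Lemma zero_sum_code s : all in3 s -> zero_sum (map code s) = sum0 s.
Proof.
move=> s3; rewrite /zero_sum /sum0 -!map_comp.
by congr (_ && _); congr (3 %| sumn _); apply/eq_in_map => x /(allP s3);
  [apply: code_div | apply: code_mod].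
Qed.

Lemma sum0_cat s t : sum0 s -> sum0 t -> sum0 (s ++ t).
Proof.
by rewrite /sum0 !map_cat !sumn_cat => /andP[f1 g1] /andP[f2 g2]; rewrite !dvdn_add.
Qed.

Lemma small_size K N s :
  all in3 s -> small K N (capped code K s) -> size s < N.
Proof.
move=> s3 /andP[lt_K]; have s9 := code_lt9 s3.
by rewrite -(part_small s9 lt_K) count_predT.
Qed.

Lemma pick_sum0 (D : pred nat) K N ms s :
  0 < K ->
  search K (small_on D K N)
    (undup (map mult (zero_pats ms))) 9 [::] ->
  all in3 s -> all (fun x => D (code x)) s -> N <= size s ->
  exists t r, [/\ perm_eq s (t ++ r), size t \in ms & sum0 t].
Proof.
move=> K0 found s3 sD leN.
case: (search_pick code s _ found)
    => [|[p [/mem_zero_pats[zp pm _] [t [r [str tp]]]]]|/orP[/(small_size s3)|]].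
- by apply/allP => p /mem_zero_pats[].
- exists t, r; split=> //; first by rewrite -(size_map code) tp.
  rewrite -zero_sum_code ?tp //.
  by move: s3; rewrite (perm_all _ str) all_cat => /andP[].
- by rewrite ltnNge leN.
case/hasP=> k; rewrite mem_iota => /andP[_ k9] /andP[nDk].
rewrite (nth_map 0) ?size_iota // nth_iota // leq_min K0 -has_count has_pred1.
by case/mapP=> x xs; rewrite add0n => kx; move: nDk; rewrite kx (allP sD).
Qed.

Lemma triple_of_nine s : all in3 s -> 9 <= size s ->
  exists t r, [/\ perm_eq s (t ++ r), size t = 3 & sum0 t].
Proof.
move=> s3 sz.
have [|t [r [str t5 t0]]] := @pick_sum0 predT 3 9 [:: 3] s isT search_triple s3 _ sz.
  exact/allP.
by move: t5; rewrite inE => /eqP t5; exists t, r.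
Qed.

Lemma six_of_ten s : all in3 s -> 10 <= size s ->
  exists t r, [/\ perm_eq s (t ++ r), size t = 6 & sum0 t].
Proof.
move=> s3 sz.
have [|t [r [str t5 t0]]] := @pick_sum0 predT 6 10 [:: 6] s isT search_six s3 _ sz.
  exact/allP.
by move: t5; rewrite inE => /eqP t5; exists t, r.
Qed.

Lemma sum0_of_five s : all in3 s -> 5 <= size s ->
  exists t r, [/\ perm_eq s (t ++ r), t != [::] & sum0 t].
Proof.
move=> s3 sz.
have [|t [r [str t5 t0]]] :=
  @pick_sum0 predT 3 5 (iota 1 5) s isT search_davenport s3 _ sz.
  exact/allP.
by exists t, r; split=> //; case: (t) t5.
Qed.

Lemma triple_of_five s : all in3 s -> all (fun x => g x == 0) s ->
  5 <= size s -> exists t r, [/\ perm_eq s (t ++ r), size t = 3 & sum0 t].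
Proof.
move=> s3 g0 sz.
have [|t [r [str t5 t0]]] :=
  @pick_sum0 (fun k => k %% 3 == 0) 3 5 [:: 3] s isT
    search_triple_axis s3 _ sz.
  by apply/allP => x xs; rewrite code_mod ?(allP s3) ?(allP g0).
by move: t5; rewrite inE => /eqP t5; exists t, r.
Qed.

End PlanePicking.

(** * Words in the Heisenberg group *)

Definition triple : Type := (nat * nat * nat)%type.
Definition cA (x : triple) : nat := x.1.1.
Definition cB (x : triple) : nat := x.1.2.
Definition cC (x : triple) : nat := x.2.

(** The alternating form of the classes modulo 3, with 2 for -1 to stay in [nat]. *)
Definition frm (x y : triple) : nat := cA x * cB y + 2 * cB x * cA y.

Definition hmul (x y : triple) : triple :=
  (cA x + cA y, cB x + cB y, cC x + cC y + frm x y).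

Definition ev (s : seq triple) : triple := foldr hmul (0, 0, 0) s.

Definition reduced (x : triple) : bool := [&& cA x < 3, cB x < 3 & cC x < 3].

Notation cls := (code cA cB).

Definition is_one (s : seq triple) : bool := sum0 cA cB s && (3 %| cC (ev s)).

Definition has_one_of_size (P : pred nat) (s : seq triple) : Prop :=
  exists t r, [/\ perm_eq s (t ++ r), P (size t) & is_one t].

Lemma evA s : cA (ev s) = sumn (map cA s).
Proof. by elim: s => //= x s <-. Qed.

Lemma evB s : cB (ev s) = sumn (map cB s).
Proof. by elim: s => //= x s <-. Qed.

Lemma evC_cons x s : cC (ev (x :: s)) = cC x + cC (ev s) + frm x (ev s).
Proof. by []. Qed.

Lemma frm_ev_cons x y s : frm x (ev (y :: s)) = frm x y + frm x (ev s).
Proof. by rewrite /frm !evA !evB /=; lia. Qed.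

Definition evE := (evC_cons, frm_ev_cons).

Lemma sum0_perm (T : eqType) (f g : T -> nat) s t :
  perm_eq s t -> sum0 f g s = sum0 f g t.
Proof. by move=> st; rewrite /sum0 !(perm_sumn (perm_map _ st)). Qed.

Lemma reduced_in3 s : all reduced s -> all (fun x => (cA x < 3) && (cB x < 3)) s.
Proof. by apply: sub_all => x /and3P[-> ->]. Qed.

Lemma cform_cls x y : reduced x -> reduced y ->
  cform (cls x) (cls y) = frm x y %% 3.
Proof.
by move=> /and3P[xA xB _] /and3P[yA yB _];
  rewrite /cform !code_div ?code_mod ?xA ?xB ?yA ?yB.
Qed.

(** Cauchy-Davenport: two sets of two residues modulo 3 have every residue in their sumset. *)
Lemma choose3 k u u' v v' : u %% 3 != u' %% 3 -> v %% 3 != v' %% 3 ->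
  [|| 3 %| k + u + v, 3 %| k + u' + v, 3 %| k + u + v' | 3 %| k + u' + v'].
Proof. lia. Qed.

(** Swapping negates the form, and a nonzero residue modulo 3 differs from its opposite. *)
Lemma frm_swap x y : frm x y %% 3 != 0 -> frm x y %% 3 != frm y x %% 3.
Proof. by rewrite /frm; lia. Qed.

Lemma arrange_two_pairs x1 x2 x3 x4 u :
  frm x1 x2 %% 3 != 0 -> frm x3 x4 %% 3 != 0 ->
  exists2 t, perm_eq [:: x1, x2, x3, x4 & u] t & 3 %| cC (ev t).
Proof.
move=> /frm_swap n12 /frm_swap n34.
(* [k] gathers the terms that swaps inside the two pairs leave unchanged. *)
pose k := cC (ev u) + cC x1 + cC x2 + cC x3 + cC x4 + frm x1 (ev u)
  + frm x2 (ev u) + frm x3 (ev u) + frm x4 (ev u) + frm x1 x3 + frm x1 x4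
  + frm x2 x3 + frm x2 x4.
have swap (a b : triple) l : perm_eq [:: a, b & l] [:: b, a & l].
  exact/permPl/(perm_catCA [:: a] [:: b] l).
case/or4P: (choose3 k n12 n34) => dvd.
- exists [:: x1, x2, x3, x4 & u] => //.
  by rewrite (_ : cC _ = k + frm x1 x2 + frm x3 x4) // /k !evE; lia.
- exists [:: x2, x1, x3, x4 & u]; first exact: swap.
  by rewrite (_ : cC _ = k + frm x2 x1 + frm x3 x4) // /k !evE; lia.
- exists [:: x1, x2, x4, x3 & u]; first by rewrite !perm_cons swap.
  by rewrite (_ : cC _ = k + frm x1 x2 + frm x4 x3) // /k !evE; lia.
exists [:: x2, x1, x4, x3 & u].
  by rewrite (perm_trans (swap _ _ _)) // !perm_cons swap.
by rewrite (_ : cC _ = k + frm x2 x1 + frm x4 x3) // /k !evE; lia.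
Qed.

(** Since [x] and [y] share a class, exchanging them alters only the central coordinate, just as
    swapping a second pair would. *)
Lemma arrange_pair_exchange x y x1 x2 u :
  cA x = cA y -> cB x = cB y -> cC x %% 3 != cC y %% 3 ->
  frm x1 x2 %% 3 != 0 ->
  exists2 z, z \in [:: x; y] &
    exists2 t, perm_eq [:: z, x1, x2 & u] t & 3 %| cC (ev t).
Proof.
move=> eA eB nC /frm_swap n12.
have frm_y w : frm y w = frm x w by rewrite /frm eA eB.
pose k := cC (ev u) + cC x1 + cC x2 + frm x1 (ev u) + frm x2 (ev u)
  + frm x (ev u) + frm x x1 + frm x x2.
have swap (c a b : triple) l : perm_eq [:: c, a, b & l] [:: c, b, a & l].
  by rewrite perm_cons; exact/permPl/(perm_catCA [:: a] [:: b] l).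
case/or4P: (choose3 k nC n12) => dvd.
- exists x; rewrite ?inE ?eqxx //; exists [:: x, x1, x2 & u] => //.
  by rewrite (_ : cC _ = k + cC x + frm x1 x2) // /k !evE; lia.
- exists y; rewrite ?inE ?eqxx ?orbT //; exists [:: y, x1, x2 & u] => //.
  by rewrite (_ : cC _ = k + cC y + frm x1 x2) // /k !evE !frm_y; lia.
- exists x; rewrite ?inE ?eqxx //; exists [:: x, x2, x1 & u] => //.
  by rewrite (_ : cC _ = k + cC x + frm x2 x1) // /k !evE; lia.
exists y; rewrite ?inE ?eqxx ?orbT //; exists [:: y, x2, x1 & u] => //.
by rewrite (_ : cC _ = k + cC y + frm x2 x1) // /k !evE !frm_y; lia.
Qed.

(** A coordinate along the line of [d]: the line of 1 is [a = 0], and on the three others [a]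
    determines [b]. *)
Definition key (d : nat) (x : triple) : nat := if d == 1 then cB x else cA x.

(** Both vectors are orthogonal to a nonzero vector of the symplectic plane, hence multiples of
    it. *)
Lemma line_commute d a b a' b' : d \in lines ->
  form (d %/ 3) (d %% 3) a b = 0 -> form (d %/ 3) (d %% 3) a' b' = 0 ->
  form a b a' b' = 0.
Proof.
rewrite [form a b _ _]formE ![form (d %/ 3) _ _ _]formE.
have [] : [/\ a %% 3 < 3, b %% 3 < 3, a' %% 3 < 3 & b' %% 3 < 3].
  by rewrite !ltn_mod.
move: (a %% 3) (b %% 3) (a' %% 3) (b' %% 3) => i j k l; rewrite !inE.
move: i j k l => [|[|[|i]]] [|[|[|j]]] [|[|[|k]]] [|[|[|l]]] // _ _ _ _;
  by case/or4P=> /eqP->.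
Qed.

Lemma line_word d s : d \in lines ->
  all (fun x => form (d %/ 3) (d %% 3) (cA x) (cB x) == 0) s ->
  form (d %/ 3) (d %% 3) (cA (ev s)) (cB (ev s)) = 0 /\
  cC (ev s) = sumn (map cC s) %[mod 3].
Proof.
move=> dl; elim: s => [|x s IHs]; first by rewrite /form !muln0.
case/andP=> /eqP xd /IHs[sd sC]; split.
  rewrite (evA (x :: s)) (evB (x :: s)) /= -evA -evB.
  by move: xd sd; move: dl; rewrite !inE => /or4P[] /eqP ->; rewrite /form /=; lia.
have := line_commute dl xd sd; rewrite /form -/(frm x (ev s)) evC_cons /=.
by move: sC; lia.
Qed.

Lemma line_is_one d s : d \in lines -> all reduced s ->
  all (fun x => cform d (cls x) == 0) s -> sum0 (key d) cC s -> is_one s.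
Proof.
move=> dl s3 sd /andP[k0 c0].
have [|d0 sC] := @line_word d s dl.
  apply/allP => x xs; have := allP sd x xs.
  have /and3P[xA xB _] := allP s3 x xs.
  by rewrite /cform code_div ?code_mod ?xA ?xB.
have kE : map (key d) s = map (if d == 1 then cB else cA) s.
  by apply: eq_map => x; rewrite /key; case: ifP.
have quo : [/\ 3 %/ 3 = 1, 4 %/ 3 = 1 & 5 %/ 3 = 1] by [].
have [q3 q4 q5] := quo.
rewrite /is_one /sum0 -evA -evB; move: d0 k0 c0 sC; rewrite kE.
by move: dl; rewrite !inE => /or4P[] /eqP ->; rewrite /form /= -?evA -?evB;
  rewrite ?q3 ?q4 ?q5; lia.
Qed.

(** Letters of one class commute, and three times any class is zero. *)
Lemma class_is_one v s : all reduced s -> all (fun x => cls x == v) s ->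
  3 %| size s -> 3 %| sumn (map cC s) -> is_one s.
Proof.
move=> s3 sv sz c0; pose a := v %/ 3; pose b := v %% 3.
have sab : all (fun x => (cA x == a) && (cB x == b)) s.
  apply/allP => x xs; have /and3P[xA xB _] := allP s3 x xs.
  by rewrite /a /b -(eqP (allP sv x xs)) code_div ?code_mod ?xA ?xB ?eqxx.
have [eA eB eC] : [/\ cA (ev s) = size s * a, cB (ev s) = size s * b &
    cC (ev s) = sumn (map cC s) %[mod 3]].
  elim: (s) sab => // x u IHu /andP[/andP[/eqP xa /eqP xb] /IHu[uA uB uC]].
  rewrite evC_cons (evA (x :: u)) (evB (x :: u)) /= -evA -evB.
  rewrite /frm xa xb uA uB !mulSn; split=> //.
  have -> : a * (size u * b) + 2 * b * (size u * a) = 3 * (size u * a * b) by lia.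
  by move: uC; lia.
rewrite /is_one /sum0 -evA -evB eA eB !dvdn_mulr //=.
by rewrite /dvdn eC; exact: c0.
Qed.

(** * Extracting product-one words from 33 and from 7 letters *)

Lemma has_one_sub (P : pred nat) (s t t' r : seq triple) :
  perm_eq s (t ++ r) -> perm_eq t t' -> P (size t) -> is_one t' -> has_one_of_size P s.
Proof.
move=> str tt' Pt one_t'; exists t', r; split=> //; last by rewrite -(perm_size tt').
by rewrite (perm_trans str) // perm_cat2r.
Qed.

Lemma reduced_sub s t r : perm_eq s (t ++ r) -> all reduced s ->
  all reduced t /\ all reduced r.
Proof. by move=> str; rewrite (perm_all _ str) all_cat => /andP. Qed.

Lemma two_pairs_word t p : all reduced t -> map cls t = p -> starts_two_pairs p ->
  exists x1 x2 x3 x4 u, [/\ t = [:: x1, x2, x3, x4 & u],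
    frm x1 x2 %% 3 != 0 & frm x3 x4 %% 3 != 0].
Proof.
move=> + <-; case: t => [|x1 [|x2 [|x3 [|x4 u]]]] //=.
case/and5P=> r1 r2 r3 r4 _ /andP[]; rewrite !cform_cls // => n12 n34.
by exists x1, x2, x3, x4, u.
Qed.

Lemma one_pair_word t p : all reduced t -> map cls t = p -> starts_pair p ->
  exists x1 x2 u, t = [:: x1, x2 & u] /\ frm x1 x2 %% 3 != 0.
Proof.
move=> + <-; case: t => [|x1 [|x2 u]] //= /and3P[r1 r2 _].
by rewrite cform_cls // => n12; exists x1, x2, u.
Qed.

Lemma sum0_word t p : all reduced t -> map cls t = p -> zero_sum p -> sum0 cA cB t.
Proof. by move=> t3 <-; rewrite zero_sum_code // reduced_in3. Qed.

(** Seven triples leave at least 10 letters. Two more triples would require 12, so the last six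
    letters are taken at once. *)
Lemma line_case27 d s : d \in lines -> all reduced s ->
  31 <= count (fun x => cform d (cls x) == 0) s ->
  has_one_of_size (pred1 27) s.
Proof.
move=> dl s3; rewrite -size_filter; set sd := filter _ s => sz.
have ss : perm_eq s (sd ++ filter (predC (fun x => cform d (cls x) == 0)) s).
  by rewrite perm_sym perm_filterC.
have [sd3 _] := reduced_sub ss s3.
have sdk : all (fun x => (key d x < 3) && (cC x < 3)) sd.
  apply: sub_all sd3 => x /and3P[xA xB xC].
  by rewrite /key xC; case: ifP; rewrite ?xA ?xB.
have [|||||t [r [str tsz t0]]] :=
  @pick_iter _ (fun x => (key d x < 3) && (cC x < 3)) (sum0 (key d) cC) 9 7 sd.
- by [].
- exact: sum0_cat.
- exact: triple_of_nine.
- by [].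
- by move: sz; lia.
have szr : 10 <= size r.
  by have := perm_size str; rewrite size_cat tsz; lia.
have rk : all (fun x => (key d x < 3) && (cC x < 3)) r.
  by move: sdk; rewrite (perm_all _ str) all_cat => /andP[].
have [t' [r' [str' tsz' t0']]] := six_of_ten rk szr.
have sE : perm_eq s ((t ++ t') ++
    (r' ++ filter (predC (fun x => cform d (cls x) == 0)) s)).
  rewrite (perm_trans ss) // catA perm_cat2r (perm_trans str) // -catA.
  by rewrite perm_cat2l.
exists (t ++ t'), (r' ++ filter (predC (fun x => cform d (cls x) == 0)) s); split=> //.
  by rewrite size_cat tsz tsz'.
have [tt3 _] := reduced_sub sE s3.
apply: (line_is_one dl tt3); last exact: sum0_cat.
have sub : perm_eq sd ((t ++ t') ++ r').
  by rewrite (perm_trans str) // -catA perm_cat2l.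
have := filter_all (fun x => cform d (cls x) == 0) s.
by rewrite -/sd (perm_all _ sub) all_cat => /andP[].
Qed.

(** Only central coordinates matter here, and triples exist among any 5 letters; after eight triples
    5 of the 29 remain for the ninth. *)
Lemma class_case29 v s : all reduced s -> 29 <= count (fun x => cls x == v) s ->
  has_one_of_size (pred1 27) s.
Proof.
move=> s3; rewrite -size_filter; set sv := filter _ s => sz.
have ss : perm_eq s (sv ++ filter (predC (fun x => cls x == v)) s).
  by rewrite perm_sym perm_filterC.
have [sv3 _] := reduced_sub ss s3.
have [|||||t [r [str tsz /andP[t0 _]]]] :=
  @pick_iter _ reduced (sum0 cC (fun=> 0)) 5 9 sv.
- by [].
- exact: sum0_cat.
- move=> u u3; apply: triple_of_five; last exact/allP.
  by apply: sub_all u3 => x /and3P[_ _ ->].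
- by [].
- by move: sz; lia.
exists t, (r ++ filter (predC (fun x => cls x == v)) s).
split; last 1 first.
- have [t3 _] := reduced_sub str sv3.
  apply: (@class_is_one v) => //; last by rewrite tsz.
  have := filter_all (fun x => cls x == v) s.
  by rewrite -/sv (perm_all _ str) all_cat => /andP[].
- by rewrite (perm_trans ss) // catA perm_cat2r.
by rewrite tsz.
Qed.

Lemma map_in_const (T : eqType) (f : T -> nat) c l :
  {in l, forall x, f x = c} -> map f l = nseq (size l) c.
Proof.
elim: l => //= x l IHl fc; rewrite fc ?mem_head // IHl // => y yl.
by rewrite fc // inE yl orbT.
Qed.

(** Unless the letters of class [v] are all equal, set aside two different ones. The word consists
    of one of them, six letters of pattern [p] and 20 more of class [v]; the 21 of class [v] have
    class sum zero. *)
Lemma class_case27 v p s : all reduced s ->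
  27 <= count (fun x => cls x == v) s -> p \in one_pair_pats 4 ->
  count_mem v p <= 4 ->
  (forall k, count_mem k p <= count_mem k (map cls s)) ->
  has_one_of_size (pred1 27) s.
Proof.
move=> s3 nv /mem_one_pair_pats[op zp szp _] pv le_ps.
have svsz := nv; rewrite -size_filter in svsz; set sv := filter _ s in svsz.
have ss : perm_eq s (sv ++ filter (predC (fun x => cls x == v)) s).
  by rewrite perm_sym perm_filterC.
have [sv3 _] := reduced_sub ss s3.
have svv : all (fun x => cls x == v) sv := filter_all _ s.
have [/allP same|/allPn[y ysv ny]] :=
  boolP (all (fun y => cC y == cC (head (0, 0, 0) sv)) sv).
  have str : perm_eq s (take 27 sv ++ (drop 27 sv ++
      filter (predC (fun x => cls x == v)) s)).
    by rewrite catA cat_take_drop.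
  exists (take 27 sv); eexists; split; [exact: str | by rewrite size_takel |].
  have [t3 _] := reduced_sub str s3.
  apply: (@class_is_one v) => //; last 2 first.
  - by rewrite size_takel.
  - rewrite (_ : map cC _ = nseq 27 (cC (head (0, 0, 0) sv))).
      by rewrite sumn_nseq dvdn_mull.
    rewrite -[X in nseq X](size_takel svsz); apply: map_in_const => x /mem_take.
    by move/same/eqP.
  by move: svv; rewrite -{1}(cat_take_drop 27 sv) all_cat => /andP[].
set x := head (0, 0, 0) sv in ny.
have xsv : x \in sv by rewrite /x; case: (sv) svsz => //= z l _; rewrite mem_head.
have xy : x != y by apply: contraNneq ny => ->.
have svE : perm_eq sv (x :: y :: rem y (rem x sv)).
  rewrite (perm_trans (perm_to_rem xsv)) // perm_cons perm_to_rem //.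
  by have := ysv; rewrite (perm_mem (perm_to_rem xsv)) inE eq_sym (negPf xy).
set s' := rem y (rem x sv) ++ filter (predC (fun x => cls x == v)) s.
have sE : perm_eq s (x :: y :: s').
  rewrite (perm_trans ss) //.
  by rewrite -[_ :: _ :: _]/((x :: y :: rem y (rem x sv)) ++ _) perm_cat2r.
have /eqP xv := allP svv x xsv; have /eqP yv := allP svv y ysv.
have cnt k : count_mem k (map cls s) = (v == k) + ((v == k) + count_mem k (map cls s')).
  by rewrite (seq.permP (perm_map cls sE)) /= xv yv.
have nvE : count (fun x => cls x == v) s = count_mem v (map cls s).
  by rewrite count_map.
have [|t [r [s'tr tp]]] := @pick_pattern _ cls s' p.
  (* Setting [x] and [y] aside lowers only the count of [v], and leaves at least 25 where [p] asks
     for at most 4. *)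
  move=> k; have := le_ps k; rewrite cnt.
  have [<- _|//] := eqVneq v k; rewrite (leq_trans pv) //.
  by move: nv; rewrite nvE cnt eqxx; move: (count_mem v _) => n; clear; lia.
set rv := filter (fun x => cls x == v) r.
have rE : perm_eq r (rv ++ filter (predC (fun x => cls x == v)) r).
  by rewrite perm_sym perm_filterC.
have szrv : 20 <= size rv.
  rewrite size_filter -(count_map cls (pred1 v)).
  have := cnt v; rewrite (seq.permP (perm_map cls s'tr)) map_cat count_cat tp.
  rewrite eqxx; have aux n m k : 27 <= n -> k <= 4 -> n = 1 + (1 + (k + m)) -> 20 <= m.
    by clear; lia.
  by apply: aux; rewrite -?nvE.
set w := take 20 rv.
have szw : size w = 20 by rewrite size_takel.
set q := drop 20 rv ++ filter (predC (fun x => cls x == v)) r.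
have s'E : perm_eq s' ((t ++ w) ++ q).
  rewrite (perm_trans s'tr) // -catA perm_cat2l (perm_trans rE) //.
  by rewrite /q /w catA cat_take_drop.
have [xy3 /andP[y3 s'3]] : reduced x /\ all reduced (y :: s').
  by move: s3; rewrite (perm_all _ sE) => /andP.
have [tw3 _] := reduced_sub s'E s'3.
have [t3 w3] : all reduced t /\ all reduced w by apply/andP; rewrite -all_cat.
have [x1 [x2 [u [tE n12]]]] := one_pair_word t3 tp op.
have coords z : reduced z -> cls z = v -> cA z = v %/ 3 /\ cB z = v %% 3.
  by move=> /and3P[zA zB _] <-; rewrite code_div ?code_mod ?zA ?zB.
have [xA xB] := coords x xy3 xv; have [yA yB] := coords y y3 yv.
have nC : cC x %% 3 != cC y %% 3.
  have /and3P[_ _ xC] := xy3; have /and3P[_ _ yC] := y3.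
  by rewrite !modn_small // eq_sym.
have [||z zin [t' tt' dvd]] := @arrange_pair_exchange x y x1 x2 (u ++ w) _ _ nC n12.
- by rewrite xA yA.
- by rewrite xB yB.
have zv : cls z = v /\ reduced z.
  by move: zin; rewrite !inE => /orP[]/eqP->.
have wv : all (fun x => cls x == v) w.
  have : all (fun x => cls x == v) rv := filter_all _ r.
  by rewrite -{1}(cat_take_drop 20 rv) all_cat => /andP[].
have zw0 : sum0 cA cB (z :: w).
  rewrite /sum0; have [-> ->] : map cA (z :: w) = nseq 21 (v %/ 3) /\
      map cB (z :: w) = nseq 21 (v %% 3).
    rewrite -[21]/(20.+1) -szw -[(size w).+1]/(size (z :: w)).
    have zwc y' : y' \in z :: w -> cA y' = v %/ 3 /\ cB y' = v %% 3.
      rewrite inE => /orP[/eqP->|yw]; first by apply: coords; case: zv.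
      by apply: coords; [apply: (allP w3) | apply/eqP/(allP wv)].
    by split; apply: map_in_const => y' /zwc[].
  by rewrite !sumn_nseq !dvdn_mull.
have big0 : sum0 cA cB t'.
  rewrite -(sum0_perm _ _ tt').
  rewrite (@sum0_perm _ _ _ _ (t ++ (z :: w))); last first.
    by rewrite tE -(cat1s z w) perm_sym perm_catCA.
  by apply: sum0_cat => //; apply: (sum0_word t3 tp zp).
(* [y'] is the one of [x] and [y] that was not chosen. *)
have [y' sE'] : exists y', perm_eq s (z :: y' :: s').
  move: zin; rewrite !inE => /orP[]/eqP->; first by exists y.
  exists x; rewrite (perm_trans sE) //.
  exact/permPl/(perm_catCA [:: x] [:: y] s').
apply: (@has_one_sub _ s [:: z, x1, x2 & u ++ w] t' (y' :: q)) => //.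
- rewrite (perm_trans sE') // (_ : [:: x1, x2 & _] = t ++ w); last by rewrite tE.
  by rewrite cat_cons perm_cons -(cat1s y' q) perm_sym perm_catCA perm_cons perm_sym.
- have := szp; rewrite -tp tE /= !size_map size_cat szw => -[->].
  by [].
by rewrite /is_one big0.
Qed.

(** The 27 letters outside the pattern just suffice for seven triples: 9 remain before the last.
    Reordering then corrects the central coordinate. *)
Lemma two_pairs_case27 p t r s : all reduced s -> size s = 33 ->
  p \in two_pair_pats 2 -> perm_eq s (t ++ r) -> map cls t = p ->
  has_one_of_size (pred1 27) s.
Proof.
move=> s3 sz33 /mem_two_pair_pats[pp zp szp _] str tp.
have [t3 r3] := reduced_sub str s3.
have szt : size t = 6 by rewrite -(size_map cls) tp szp.
have szr : size r = 27.
  by apply/eqP; rewrite -(eqn_add2l 6) -{1}szt -size_cat -(perm_size str) sz33.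
have [|||||w [q [rwq szw w0]]] :=
  @pick_iter _ (fun x => (cA x < 3) && (cB x < 3)) (sum0 cA cB) 9 7 r.
- by [].
- exact: sum0_cat.
- exact: triple_of_nine.
- exact: reduced_in3.
- by rewrite szr.
have [x1 [x2 [x3 [x4 [u [tE n12 n34]]]]]] := two_pairs_word t3 tp pp.
have [t' tt' dvd] := arrange_two_pairs (u ++ w) n12 n34.
apply: (@has_one_sub _ s (t ++ w) t' q).
- by rewrite (perm_trans str) // -catA perm_cat2l.
- by rewrite tE.
- by rewrite /= size_cat szt szw.
rewrite /is_one dvd andbT -(sum0_perm _ _ tt').
rewrite (_ : [:: x1, x2, x3, x4 & _] = t ++ w); last by rewrite tE.
by apply: sum0_cat => //; apply: sum0_word tp zp.
Qed.

Lemma has_one_of_33 s : all reduced s -> size s = 33 ->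
  has_one_of_size (pred1 27) s.
Proof.
move=> s3 sz33; have s9 := code_lt9 (reduced_in3 s3).
have cntC (P : pred triple) : count P s = 33 - count (predC P) s.
  by rewrite -sz33 -(count_predC P s) addnK.
have [|[p [pin [t [r [str tp]]]]]|] := search_pick cls s _ search_33.
- by apply/allP => p /mem_two_pair_pats[].
- exact: two_pairs_case27 pin str tp.
rewrite /leaf33; case: ifP => [/(small_size (reduced_in3 s3))|_].
  by rewrite sz33.
case: ifP => [/hasP[d dl /andP[lt4 le2]] _|_].
  apply: (line_case27 dl s3); rewrite cntC.
  by move: le2; rewrite -(part_small s9 lt4); move: (count _ _) => n; clear; lia.
case/hasP=> v _; case: ifP => // /negbFE lt4.
have := part_small s9 lt4; set o := sumn _ => oE.
have nv : count (fun x => cls x == v) s = 33 - o by rewrite cntC -oE.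
case: ifP => [o4 _|_].
  by apply: (class_case29 (v := v) s3); rewrite nv; move: o4; clear; lia.
case: ifP => // o6 /hasP[p pin /andP[pv /allP le_p]].
apply: (class_case27 s3 _ pin pv).
  by rewrite nv; move: o6; clear; lia.
move=> k; have [_ _ _ p9] := mem_one_pair_pats pin.
have [k9|k9] := ltnP k 9; last first.
  rewrite (_ : count_mem k p = 0) //; apply/count_memPn/negP => kp.
  by have := allP p9 _ kp; rewrite ltnNge k9.
have := le_p k; rewrite mem_iota k9 => /(_ isT).
rewrite (nth_map 0) ?size_iota // nth_iota // add0n => le_k.
exact: leq_trans le_k (geq_minr _ _).
Qed.

Lemma ev_rem0 s : ev (rem (0, 0, 0) s) = ev s.
Proof.
elim: s => //= x s IHs; case: eqP => [->|_]; last by rewrite /= IHs.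
by case: (ev s) => -[a b] c; rewrite /hmul /frm /= !addn0.
Qed.

Lemma has_one_of_7 s : all reduced s -> size s = 7 -> has_one_of_size (leq 1) s.
Proof.
move=> s3 sz7; have s9 := code_lt9 (reduced_in3 s3).
have [|[p [pin [t [r [str tp]]]]]|] := search_pick cls s _ search_7.
- apply/allP => p; rewrite mem_cat => /orP[/flatten_mapP[m _ /mem_two_pair_pats[]]|] //.
  by case/mapP=> q /mem_one_pair_pats[_ _ _ q9] -> /=.
- have [t3 r3] := reduced_sub str s3; move: pin.
  rewrite mem_cat => /orP[/flatten_mapP[m _ /mem_two_pair_pats[pp zp szp _]]|].
    have [x1 [x2 [x3 [x4 [u [tE n12 n34]]]]]] := two_pairs_word t3 tp pp.
    have [t' tt' dvd] := arrange_two_pairs u n12 n34; rewrite -tE in tt'.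
    apply: (has_one_sub str tt'); first by rewrite tE.
    by rewrite /is_one dvd andbT -(sum0_perm _ _ tt') (sum0_word t3 tp zp).
  case/mapP=> q /mem_one_pair_pats[op zq _ _] pE; move: str t3 tp; rewrite {}pE.
  case: t => [//|x t] str /andP[x3 t3] [x0 tq].
  have [xA xB] : cA x = 0 /\ cB x = 0.
    by have /and3P[zA zB _] := x3; move: x0; rewrite /code; lia.
  have t0 := sum0_word t3 tq zq.
  have [x1 [x2 [u [tE n12]]]] := one_pair_word t3 tq op.
  have [xC|xC] := boolP (3 %| cC x).
    exists [:: x], (t ++ r); split=> //.
    by rewrite /is_one /sum0 evC_cons /= xA xB /frm xA xB /= !addn0.
  (* Taking the trivial letter in place of [x] means leaving [x] out. *)
  have [|z zin [t' tt' dvd]] :=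
    @arrange_pair_exchange x (0, 0, 0) x1 x2 u xA xB _ n12; first exact: xC.
  move: zin tt'; rewrite -tE !inE => /orP[]/eqP-> tt'.
    apply: (has_one_sub str tt') => //; rewrite /is_one dvd andbT.
    by rewrite -(sum0_perm _ _ tt') (@sum0_cat _ _ _ [:: x]) // /sum0 /= xA xB.
  have t't : perm_eq t (rem (0, 0, 0) t').
    rewrite -(perm_cons (0, 0, 0)) (perm_trans tt') // perm_to_rem //.
    by rewrite -(perm_mem tt') mem_head.
  have str' : perm_eq s (t ++ (x :: r)).
    by rewrite (perm_trans str) // -(cat1s x r) perm_sym perm_catCA.
  apply: (has_one_sub str' t't); first by rewrite tE.
  by rewrite /is_one ev_rem0 dvd andbT -(sum0_perm _ _ t't).
rewrite /leaf7; case: ifP => [/(small_size (reduced_in3 s3))|_].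
  by rewrite sz7.
case/hasP=> d dl le5.
(* Capping only lowers counts, so five letters really lie in an abelian subgroup of order 9. *)
have {le5} := leq_trans le5 (part_le _ _ s9).
rewrite -size_filter; set sd := filter _ s => sz.
have ss : perm_eq s (sd ++ filter (predC (fun x => cform d (cls x) == 0)) s).
  by rewrite perm_sym perm_filterC.
have [sd3 _] := reduced_sub ss s3.
have sdk : all (fun x => (key d x < 3) && (cC x < 3)) sd.
  apply: sub_all sd3 => x /and3P[xA xB xC].
  by rewrite /key xC; case: ifP; rewrite ?xA ?xB.
have [t [r [str tn0 t0]]] := sum0_of_five sdk sz.
have [t3 _] := reduced_sub str sd3.
exists t, (r ++ filter (predC (fun x => cform d (cls x) == 0)) s); split.
- by rewrite (perm_trans ss) // catA perm_cat2r.
- by rewrite lt0n size_eq0.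
apply: (line_is_one dl t3 _ t0).
have := filter_all (fun x => cform d (cls x) == 0) s.
by rewrite -/sd (perm_all _ str) all_cat => /andP[].
Qed.

(** * The nonabelian group of order 27 and exponent 3 *)

Section Coordinates.
Variables (gT : finGroupType) (G : {group gT}) (x y z : gT).
Hypotheses (oG : #|G| = 27) (Gx : x \in G) (Gy : y \in G).
Hypotheses (x3 : (x ^+ 3 = 1)%g) (y3 : (y ^+ 3 = 1)%g) (oz : #[z]%g = 3).
Hypotheses (zE : z = [~ y, x]%g) (cxz : commute x z) (cyz : commute y z).

(* The exponent [c + 2ab] of [z] makes the cocycle of [hmul] alternating, so
   that commuting elements multiply coordinatewise. *)
Definition val3 (t : triple) : gT :=
  (x ^+ cA t * y ^+ cB t * z ^+ (cC t + 2 * cA t * cB t)%N)%g.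

Lemma swap_xy a b : (y ^+ b * x ^+ a = x ^+ a * y ^+ b * z ^+ (b * a)%N)%g.
Proof.
by rewrite commgC commXXg -?zE //; apply: commute_sym.
Qed.

Lemma expz_mod m n : m = n %[mod 3] -> (z ^+ m = z ^+ n)%g.
Proof. by move=> mn; apply/eqP; rewrite eq_expg_mod_order oz mn. Qed.

Lemma val3M s t : (val3 s * val3 t)%g = val3 (hmul s t).
Proof.
rewrite /val3 /hmul /cA /cB /cC /= -/(cA s) -/(cB s) -/(cC s) -/(cA t) -/(cB t) -/(cC t).
have zx m n : commute (z ^+ m)%g (x ^+ n)%g by apply/commuteX2/commute_sym.
have zy m n : commute (z ^+ m)%g (y ^+ n)%g by apply/commuteX2/commute_sym.
rewrite !mulgA -(mulgA _ (z ^+ _)%g (x ^+ _)%g) zx mulgA.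
rewrite -(mulgA _ (z ^+ _)%g (y ^+ _)%g) zy mulgA.
rewrite -(mulgA _ (y ^+ _)%g (x ^+ _)%g) swap_xy !mulgA -expgD.
rewrite -(mulgA _ (z ^+ _)%g (y ^+ _)%g) zy mulgA -(mulgA _ (y ^+ _)%g (y ^+ _)%g) -expgD.
rewrite -!mulgA -!expgD; congr (_ * (_ * _))%g; apply: expz_mod.
rewrite /frm; set a := cA s; set b := cB s; set a' := cA t; set b' := cB t.
(* The two exponents of [z] differ by [3 * (a * b' + a' * b)]. *)
by rewrite -[LHS](modnMDl (a * b' + a' * b)); congr (_ %% 3); lia.
Qed.

Lemma val3_ev s : val3 (ev s) = (\prod_(t <- map val3 s) t)%g.
Proof.
elim: s => [|t s IHs]; first by rewrite big_nil /val3 !expg0 !mulg1.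
by rewrite /= big_cons -IHs val3M.
Qed.

Lemma val3_eq1 t : 3 %| cA t -> 3 %| cB t -> 3 %| cC t -> val3 t = 1%g.
Proof.
move=> /dvdnP[a aE] /dvdnP[b bE] /dvdnP[c cE]; rewrite /val3.
rewrite (_ : (z ^+ _)%g = 1%g); last first.
  by apply/eqP; rewrite -order_dvdn oz bE cE dvdn_add ?dvdn_mull.
by rewrite aE bE !(mulnC _ 3) !expgM x3 y3 !expg1n !mulg1.
Qed.

(** Value 1 makes [x ^+ cA t] commute with [y], but their commutator is [z ^+ cA t], so 3 divides
    [cA t]. The same argument treats [cB t], and then only a power of [z] is left. *)
Lemma val3_eq1_inv t : val3 t = 1%g -> [/\ 3 %| cA t, 3 %| cB t & 3 %| cC t].
Proof.
rewrite /val3; set n := cC t + _ => t1.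
have cz m : commute y (z ^+ m)%g by apply: commuteX.
have a0 : 3 %| cA t.
  have xE : (x ^+ cA t = (z ^+ n)^-1 * (y ^+ cB t)^-1)%g.
    by apply: (mulIg (y ^+ cB t)%g); apply: (mulIg (z ^+ n)%g); rewrite t1 mulgKV mulVg.
  have cyx : commute (y ^+ 1)%g (x ^+ cA t)%g.
    rewrite expg1 xE; apply: commuteM; first exact/commuteV.
    exact/commuteV/commuteX.
  have := swap_xy (cA t) 1; rewrite cyx -{1}[LHS]mulg1 => /mulgI/esym/eqP.
  by rewrite -order_dvdn oz mul1n.
have xa : (x ^+ cA t = 1)%g by have /dvdnP[a ->] := a0; rewrite mulnC expgM x3 expg1n.
rewrite xa mul1g in t1.
have b0 : 3 %| cB t.
  have yE : (y ^+ cB t = (z ^+ n)^-1)%g by apply: (mulIg (z ^+ n)%g); rewrite t1 mulVg.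
  have cyx : commute (y ^+ cB t)%g (x ^+ 1)%g.
    by rewrite expg1 yE; apply/commute_sym/commuteV/commuteX.
  have := swap_xy 1 (cB t); rewrite cyx -{1}[LHS]mulg1 => /mulgI/esym/eqP.
  by rewrite -order_dvdn oz muln1.
have yb : (y ^+ cB t = 1)%g by have /dvdnP[b ->] := b0; rewrite mulnC expgM y3 expg1n.
move: t1; rewrite yb mul1g => /eqP; rewrite -order_dvdn oz /n.
by rewrite dvdn_addl ?dvdn_mull // => ->.
Qed.

Lemma val3_inj s t : reduced s -> reduced t -> val3 s = val3 t -> s = t.
Proof.
case: s t => [[a b] c] [[a' b'] c'] /and3P[+ + +] /and3P[].
rewrite /cA /cB /cC /= => a3 b3 c3 a3' b3' c3' st.
(* [t'] stands for the inverse of the second triple, as 2 is -1 modulo 3. *)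
pose t' : triple := (2 * a', 2 * b', 2 * c').
have t1 : val3 (hmul (a', b', c') t') = 1%g.
  by apply: val3_eq1; rewrite /hmul /t' /frm /cA /cB /cC /=; apply/dvdnP;
    [exists a' | exists b' | exists (c' + 2 * a' * b')]; lia.
have := val3M (a, b, c) t'; rewrite st val3M t1 => /esym/val3_eq1_inv[].
rewrite /hmul /t' /frm /cA /cB /cC /= => da db dc.
have aE : a = a' by move: da; clear dc; lia.
have bE : b = b' by move: db; clear dc; lia.
move: dc; rewrite aE bE (_ : _ + _ = c + 2 * c' + (2 * a' * b') * 3); last by lia.
by rewrite dvdn_addl ?dvdn_mull // => dc; congr (_, _, _); lia.
Qed.

Lemma val3_in t : val3 t \in G.
Proof. by rewrite /val3 zE groupM ?groupM ?groupX ?groupR. Qed.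

Lemma val3_surj g : g \in G ->
  exists t : 'I_3 * 'I_3 * 'I_3, val3 (t.1.1 : nat, t.1.2 : nat, t.2 : nat) = g.
Proof.
pose f (t : 'I_3 * 'I_3 * 'I_3) := val3 (t.1.1 : nat, t.1.2 : nat, t.2 : nat).
have finj : injective f.
  move=> [[i j] k] [[i' j'] k'] /val3_inj; rewrite /reduced /cA /cB /cC /= !ltn_ord.
  by case/(_ isT isT)=> /val_inj-> /val_inj-> /val_inj->.
suff <- : f @: setT = G by case/imsetP=> t _ ->; exists t.
apply/eqP; rewrite eqEcard card_imset // cardsT !card_prod !card_ord oG andbT.
by apply/subsetP => _ /imsetP[t _ ->]; apply: val3_in.
Qed.

(** The default outside [G] is reduced as well, so [coord_reduced] holds for every element. *)
Definition coord (g : gT) : triple :=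
  if [pick t : 'I_3 * 'I_3 * 'I_3 |
      val3 (t.1.1 : nat, t.1.2 : nat, t.2 : nat) == g] is Some t
  then (t.1.1 : nat, t.1.2 : nat, t.2 : nat) else (0, 0, 0).

Lemma coord_reduced g : reduced (coord g).
Proof. by rewrite /coord; case: pickP => //= t _; rewrite /reduced !ltn_ord. Qed.

Lemma coordK g : g \in G -> val3 (coord g) = g.
Proof.
case/val3_surj=> t tg; rewrite /coord; case: pickP => [u /eqP //|/(_ t)].
by rewrite tg eqxx.
Qed.

Lemma val3K t : reduced t -> coord (val3 t) = t.
Proof.
by move=> t3; apply: val3_inj; rewrite ?coord_reduced ?coordK ?val3_in.
Qed.

Lemma product_one_of_word (P : pred nat) s : ~~ P 0 -> seq_over G s ->
  has_one_of_size P (map coord s) ->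
  exists m, P (size (mask m s)) /\ product_one (mask m s).
Proof.
move=> P0 /allP sG [t [r [str Pt /andP[/andP[a0 b0] c0]]]].
have sE : map val3 (map coord s) = s.
  by rewrite -map_comp map_id_in // => g /sG; apply: coordK.
have := perm_map val3 str; rewrite sE map_cat => s_tr.
have [u /subseqP[m _ ->] tu] : exists2 u, subseq u s & perm_eq (map val3 t) u.
  by apply/count_subseqP => g; rewrite (seq.permP s_tr) count_cat leq_addr.
exists m; have szu := perm_size tu; rewrite size_map in szu.
split; first by rewrite -szu.
split; first by rewrite -size_eq0 -szu; apply: contraNneq P0 => <-.
exists (map val3 t) => //.
by rewrite -val3_ev; apply: val3_eq1; rewrite ?evA ?evB.
Qed.

(* [x, x, y, y, z, z] together with [n] times the identity. *)
Definition extremal (n : nat) : seq triple :=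
  [:: (1, 0, 0); (1, 0, 0); (0, 1, 0); (0, 1, 0); (0, 0, 1); (0, 0, 1)]
  ++ nseq n (0, 0, 0).

Lemma sumn_mask (f : triple -> nat) m s : sumn (map f (mask m s)) <= sumn (map f s).
Proof.
by elim: s m => [|t s IHs] [|[] m] //=;
  rewrite ?mask0 ?leq_add2l ?(leq_trans (IHs m)) ?leq_addl.
Qed.

(** Each coordinate sums to at most 2 over the sequence, so a sum divisible by 3 over a subsequence
    is 0: only identity letters occur in it. *)
Lemma extremal_product_one n m :
  product_one (mask m (map val3 (extremal n))) ->
  size (mask m (map val3 (extremal n))) <= n.
Proof.
rewrite -map_mask size_map; set u := mask m _ => -[_ [t tu t1]].
have u3 : all reduced u.
  by apply/allP => v /mem_mask; rewrite mem_cat mem_nseq !inE -!orbA;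
    do ![case/orP=> [/eqP->|] //] => /andP[_ /eqP->].
pose u' := map coord t.
have uu' : perm_eq u' u.
  rewrite /u' (perm_trans (perm_map coord tu)) // -map_comp map_id_in // => v /(allP u3).
  exact: val3K.
have tE : map val3 u' = t.
  rewrite -map_comp map_id_in // => g; rewrite (perm_mem tu) => /mapP[v _ ->] /=.
  by rewrite coordK // val3_in.
have [] := @val3_eq1_inv (ev u'); first by rewrite val3_ev tE.
rewrite evA evB => a3 b3 c3.
have small0 f : sumn (map f (extremal n)) = 2 -> 3 %| sumn (map f u') ->
    forall v, v \in u' -> f v = 0.
  move=> f2; have := sumn_mask f m (extremal n); rewrite f2 -/u.
  rewrite -(perm_sumn (perm_map f uu')) => le2 dvd v vu.
  have /eqP : sumn (map f u') == 0 by move: dvd le2; case: (sumn _) => [|[|[|]]].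
  rewrite (perm_sumn (perm_map f (perm_to_rem vu))) /= => /eqP.
  by rewrite addn_eq0 => /andP[/eqP].
have sum_nseq (f : triple -> nat) : f (0, 0, 0) = 0 ->
    sumn (map f (nseq n (0, 0, 0))) = 0.
  by move=> f0; rewrite map_nseq sumn_nseq f0.
have A0 v : v \in u' -> cA v = 0.
  by apply: small0 => //; rewrite map_cat sumn_cat sum_nseq.
have B0 v : v \in u' -> cB v = 0.
  by apply: small0 => //; rewrite map_cat sumn_cat sum_nseq.
have C0 v : v \in u' -> cC v = 0.
  apply: small0; first by rewrite map_cat sumn_cat sum_nseq.
  (* Once the first two coordinates vanish, so do the forms, and central coordinates add. *)
  suff <- : cC (ev u') = sumn (map cC u') by [].
  elim: (u') A0 B0 => // w l IHl A0 B0.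
  have w0 : frm w (ev l) = 0 by rewrite /frm (A0 w) ?mem_head // (B0 w) ?mem_head.
  rewrite evC_cons w0 addn0 IHl // => w' wl.
    by rewrite A0 // inE wl orbT.
  by rewrite B0 // inE wl orbT.
have u0 : all (pred1 (0, 0, 0)) u.
  apply/allP => v; rewrite -(perm_mem uu') => vu /=.
  case: v vu => [[a b] c] vu; apply/eqP.
  by rewrite (A0 _ vu : a = 0) (B0 _ vu : b = 0) (C0 _ vu : c = 0).
have zn : count_mem (0, 0, 0) (extremal n) = n.
  by rewrite count_cat count_nseq /= mul1n.
by move: u0; rewrite all_count => /eqP <-; rewrite -[leqRHS]zn leq_count_mask.
Qed.

End Coordinates.

(** The center of a nontrivial 3-group is nontrivial, so the central quotient has order at most 9
    and is abelian. *)
Lemma center_contains_der1 (gT : finGroupType) (G : {group gT}) :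
  #|G| = 27 -> (G^`(1) \subset 'Z(G))%g.
Proof.
move=> oG; have pG : (3.-group G)%g by rewrite /pgroup oG.
apply: der1_min; first exact: char_norm (center_char G).
have pQ : (3.-group (G / 'Z(G)))%g by apply: quotient_pgroup.
apply: (p2group_abelian pQ).
have nZ : ('Z(G) != 1)%g.
  apply/eqP => /(trivg_center_pgroup pG) G1.
  by move: oG; rewrite G1 cards1.
have [_ d3 _] := pgroup_pdiv (pgroupS (center_sub G) pG) nZ.
have := Lagrange (center_sub G); rewrite oG => E.
rewrite card_quotient ?(char_norm (center_char G)) //.
have := congr1 (logn 3) E; rewrite lognM ?cardG_gt0 ?indexg_gt0 //.
rewrite (_ : logn 3 27 = 3) // => E3.
have Z0 : 0 < logn 3 #|'Z(G)%g| by rewrite logn_gt0 mem_primes d3 cardG_gt0.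
by rewrite -(leq_add2l (logn 3 #|'Z(G)%g|)) E3 addn2 !ltnS.
Qed.

Lemma noncommuting_generators (gT : finGroupType) (G : {group gT}) :
  #|G| = 27 -> ~~ abelian G -> exponent G = 3 ->
  exists x y : gT, [/\ x \in G, y \in G, (x ^+ 3 = 1)%g, (y ^+ 3 = 1)%g &
    [/\ #[[~ y, x]]%g = 3, commute x [~ y, x]%g & commute y [~ y, x]%g]].
Proof.
move=> oG nab eG.
have exp3 g : g \in G -> (g ^+ 3 = 1)%g by rewrite -eG; apply: expg_exponent.
case/subsetPn: nab => x Gx; rewrite -sub_cent1 => /subsetPn[y Gy nxy].
have /centerP[Gz cz] : [~ y, x]%g \in 'Z(G)%g.
  by apply: (subsetP (center_contains_der1 oG)); apply: mem_commg.
exists x, y; split; rewrite ?exp3 //; split; last 2 first.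
- exact/commute_sym/cz.
- exact/commute_sym/cz.
apply: nt_prime_order; rewrite ?exp3 //.
by apply: contra nxy => /commgP xy; apply/cent1P.
Qed.

Theorem theorem3p5 (gT : finGroupType) (G : {group gT}) :
  #|G| = 27 -> ~~ abelian G -> exponent G = 3 ->
  [/\ (forall s : seq gT, seq_over G s -> size s = 33 ->
         has_p1_subseq_of_length s 27),
      is_gao_constant G 33 &
      exists d, is_small_davenport G d /\ 33 = d + #|G|].
Proof.
move=> oG nab eG.
have [x [y [Gx Gy x3 y3 [oz cxz cyz]]]] := noncommuting_generators oG nab eG.
set z := [~ y, x]%g in oz cxz cyz.
pose W n := map (val3 x y z) (extremal n).
have WG n : seq_over G (W n).
  by apply/allP => _ /mapP[t _ ->]; apply: val3_in.
have szW n : size (W n) = 6 + n by rewrite size_map size_cat size_nseq.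
have W1 n m : product_one (mask m (W n)) -> size (mask m (W n)) <= n.
  exact: (@extremal_product_one _ G x y z).
have red s : all reduced (map (coord x y z) s).
  by apply/allP => _ /mapP[g _ ->]; apply: coord_reduced.
have sub (s : seq gT) n m : exists m', mask m (take n s) = mask m' s.
  have /subseqP[m' _ ->] : subseq (mask m (take n s)) s.
    exact: subseq_trans (mask_subseq _ _) (take_subseq _ _).
  by exists m'.
have overT n s : seq_over G s -> seq_over G (take n s).
  by move/allP=> sG; apply/allP => g /mem_take/sG.
have gao33 s : seq_over G s -> 33 <= size s -> has_p1_subseq_of_length s 27.
  move=> sG sz.
  have [|m [/eqP szm pm]] := @product_one_of_word _ G x y z oG Gx Gy x3 y3 oz erefl
      cxz cyz (pred1 27) (take 33 s) isT (overT _ _ sG).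
    by apply: has_one_of_33; rewrite ?size_map ?size_takel.
  by have [m' E] := sub s 33 m; exists m'; rewrite -E.
split.
- by move=> s sG sz; apply: gao33; rewrite ?sz.
- split=> [|N' gaoN']; first by rewrite /gao_property oG.
  (* [W 26] has 32 terms, and its product-one subsequences have length at most 26. *)
  rewrite leqNgt; apply/negP => lt33.
  have [|m [szm /W1]] := gaoN' (W 26) (WG 26); first by rewrite szW.
  by rewrite szm oG.
exists 6; rewrite oG; split=> //; split.
  (* Without identity letters, a product-one subsequence would have length 0. *)
  exists (W 0); split; rewrite ?szW // => -[m p1]; have := W1 _ _ p1.
  by case: p1 => + _; rewrite -size_eq0 leqn0 => /negPf->.
move=> s sG no1; rewrite leqNgt; apply/negP => lt6; apply: no1.
have [|m [_ pm]] := @product_one_of_word _ G x y z oG Gx Gy x3 y3 oz erefl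
    cxz cyz (leq 1) (take 7 s) isT (overT _ _ sG).
  by apply: has_one_of_7; rewrite ?size_map ?size_takel.
by have [m' E] := sub s 7 m; exists m'; rewrite -E.
Qed.
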